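(* The group $\tilde G=\langle a,\tilde b,\tilde c,\tilde d\rangle$ contains (non-trivial) elements of finite order and elements of infinite order.
   Context: Let $\mathcal T_2=\{0,1\}^*$ be the binary rooted tree; automorphisms act on the left on finite words. For a letter $x\in\{0,1\}$ let $\overline x=x+1\bmod 2$. The automorphism $a$ is given by $a(x\sigma)=\overline x\sigma$. The automorphisms $\tilde b,\tilde c,\tilde d$ of $\mathcal T_2$ are defined recursively (all fixing both vertices of the first level) by $\tilde b(0x\sigma)=0\overline x\sigma$, $\tilde b(1\sigma)=1\tilde c(\sigma)$; $\tilde c(0\sigma)=0\sigma$, $\tilde c(1\sigma)=1\tilde d(\sigma)$; $\tilde d(0\sigma)=0\sigma$, $\tilde d(1\sigma)=1\tilde b(\sigma)$. $\tilde G$ is the subgroup of $\operatorname{Aut}(\mathcal T_2)$ generated by $a,\tilde b,\tilde c,\tilde d$. *)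

(* Defs.v *)
From HB Require Import structures.
From mathcomp Require Import all_boot.
From mathcomp Require Import boolp classical_sets.

Set Implicit Arguments.
Unset Strict Implicit.
Unset Printing Implicit Defensive.

Local Open Scope group_scope.

(* Vertices of the rooted binary tree: finite words over {0, 1}, with 0 encoded
   as false and 1 as true; the first letter is the head, the root is [::]. *)
Definition word := seq bool.

Definition child (u v : word) : Prop := exists x : bool, v = rcons u x.

Definition adjacent (u v : word) : Prop := child u v \/ child v u.

Record treeAut := TreeAut {
  aut_fun :> word -> word;
  aut_inv : word -> word;
  aut_funK : cancel aut_fun aut_inv;
  aut_invK : cancel aut_inv aut_fun;
  aut_root : aut_fun [::] = [::];
  aut_adj : forall u v, adjacent (aut_fun u) (aut_fun v) <-> adjacent u v }.

Lemma treeAutP (f g : treeAut) : f =1 g -> f = g.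
Proof.
case: f g => [f f' fK f'K f1 fA] [g g' gK g'K g1 gA] /= /funext efg.
subst g.
have e' : f' = g' by apply/funext => w; rewrite -{1}(g'K w) fK.
by subst g'; congr TreeAut; apply: Prop_irrelevance.
Qed.

Definition idAut : treeAut :=
  @TreeAut id id (fun=> erefl) (fun=> erefl) erefl (fun u v => iff_refl _).

Section Operations.
Variables f g : treeAut.

Fact comp_root : (f \o g) [::] = [::].
Proof. by rewrite /= !aut_root. Qed.

Fact comp_adj u v : adjacent ((f \o g) u) ((f \o g) v) <-> adjacent u v.
Proof. by rewrite /= !aut_adj. Qed.

Definition compAut : treeAut :=
  TreeAut (can_comp (@aut_funK f) (@aut_funK g))
    (can_comp (@aut_invK g) (@aut_invK f)) comp_root comp_adj.

Fact inv_root : aut_inv f [::] = [::].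
Proof. by rewrite -{1}(aut_root f) aut_funK. Qed.

Fact inv_adj u v : adjacent (aut_inv f u) (aut_inv f v) <-> adjacent u v.
Proof. by rewrite -(aut_adj f) !aut_invK. Qed.

Definition invAut : treeAut :=
  TreeAut (@aut_invK f) (@aut_funK f) inv_root inv_adj.

End Operations.

HB.instance Definition _ := gen_eqMixin treeAut.
HB.instance Definition _ := gen_choiceMixin treeAut.

Fact compAutA : associative compAut.
Proof. by move=> f g h; apply: treeAutP. Qed.
Fact compAut1 : left_id idAut compAut.
Proof. by move=> f; apply: treeAutP. Qed.
Fact compAut1r : right_id idAut compAut.
Proof. by move=> f; apply: treeAutP. Qed.
Fact compAutV : left_inverse idAut invAut compAut.
Proof. by move=> f; apply: treeAutP => w /=; rewrite aut_funK. Qed.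
Fact compAutVr : right_inverse idAut invAut compAut.
Proof. by move=> f; apply: treeAutP => w /=; rewrite aut_invK. Qed.

(* Left action: (g * h) w = g (h w). *)
HB.instance Definition _ := isGroup.Build treeAut
  compAutA compAut1 compAut1r compAutV compAutVr.

Definition a_fun (w : word) : word :=
  if w is x :: s then ~~ x :: s else [::].

(* The words not covered by the defining recursions, [::] and (for b) the
   first-level vertex 0, are fixed. *)
Fixpoint b_fun (w : word) : word :=
  match w with
  | false :: x :: s => false :: ~~ x :: s
  | true :: s => true :: c_fun s
  | _ => w
  end
with c_fun (w : word) : word :=
  match w with
  | true :: s => true :: d_fun s
  | _ => w
  end
with d_fun (w : word) : word :=
  match w with
  | true :: s => true :: b_fun s
  | _ => w
  end.

Lemma a_funK : involutive a_fun.
Proof. by case=> //= x s; rewrite negbK. Qed.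

Lemma bcd_funK w :
  [/\ b_fun (b_fun w) = w, c_fun (c_fun w) = w & d_fun (d_fun w) = w].
Proof.
elim: w => //= -[] s [IHb IHc IHd] /=; first by rewrite IHb IHc IHd.
by split=> //; case: s {IHb IHc IHd} => //= x s; rewrite negbK.
Qed.

Lemma b_funK : involutive b_fun. Proof. by move=> w; case: (bcd_funK w). Qed.
Lemma c_funK : involutive c_fun. Proof. by move=> w; case: (bcd_funK w). Qed.
Lemma d_funK : involutive d_fun. Proof. by move=> w; case: (bcd_funK w). Qed.

Lemma a_child u v : child u v -> child (a_fun u) (a_fun v).
Proof.
by case=> x ->; case: u => [|y s]; [exists (~~ x) | exists x].
Qed.

Lemma bcd_child x u :
  [/\ child (b_fun u) (b_fun (rcons u x)), child (c_fun u) (c_fun (rcons u x))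
    & child (d_fun u) (d_fun (rcons u x))].
Proof.
have childS y s t : child s t -> child (y :: s) (y :: t).
  by case=> z ->; exists z.
elim: u => [|y s [IHb IHc IHd]] /=.
  by case: x; split; eexists (_ : bool); reflexivity.
case: y; first by split; apply: childS.
split; [|by exists x|by exists x].
by case: s {IHb IHc IHd} => [|z s] /=; [exists (~~ x) | exists x].
Qed.

Lemma b_child u v : child u v -> child (b_fun u) (b_fun v).
Proof. by case=> x ->; case: (bcd_child x u). Qed.
Lemma c_child u v : child u v -> child (c_fun u) (c_fun v).
Proof. by case=> x ->; case: (bcd_child x u). Qed.
Lemma d_child u v : child u v -> child (d_fun u) (d_fun v).
Proof. by case=> x ->; case: (bcd_child x u). Qed.

Lemma involutive_adj (f : word -> word) : involutive f ->
  (forall u v, child u v -> child (f u) (f v)) ->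
  forall u v, adjacent (f u) (f v) <-> adjacent u v.
Proof.
move=> fK fC.
have fA u v : adjacent u v -> adjacent (f u) (f v).
  by case=> /fC; [left | right].
by move=> u v; split=> [/fA|/fA//]; rewrite !fK.
Qed.

Definition a : treeAut :=
  TreeAut a_funK a_funK erefl (involutive_adj a_funK a_child).
Definition b_tilde : treeAut :=
  TreeAut b_funK b_funK erefl (involutive_adj b_funK b_child).
Definition c_tilde : treeAut :=
  TreeAut c_funK c_funK erefl (involutive_adj c_funK c_child).
Definition d_tilde : treeAut :=
  TreeAut d_funK d_funK erefl (involutive_adj d_funK d_child).

Definition is_subgroup (gT : groupType) (H : set gT) : Prop :=
  group_closed (mem H).

Definition generated_subgroup (gT : groupType) (A : set gT) : set gT :=
  smallest (@is_subgroup gT) A.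

Definition G_tilde : set treeAut :=
  generated_subgroup [set a; b_tilde; c_tilde; d_tilde]%classic.

Definition has_finite_order (gT : groupType) (g : gT) : Prop :=
  exists2 n : nat, 0 < n & g ^+ n = 1.

Definition has_infinite_order (gT : groupType) (g : gT) : Prop :=
  ~ has_finite_order g.

(* Main.v *)
Require Import Defs.
From mathcomp Require Import all_boot.
From mathcomp Require Import boolp classical_sets.

Local Open Scope group_scope.

(** The generator [a] is an involution, which gives a non-trivial element of
    finite order. For infinite order, write [g = (g0, g1)] when [g] fixes the
    first level and has sections [g0] and [g1] at the vertices 0 and 1. The
    generators satisfy [b = (a, c)], [c = (1, d)], [d = (1, b)], and [b], [c],
    [d] commute, so that [t = b c d] satisfies [t = (a, t)]. Conjugation by [a]
    swaps the two sections, hence [(a t)^2 = (t a, a t)]: the square of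
    [g = a t] fixes the first level and acts below the vertex 1 as [g].
    If [g] had a positive period [n], then [n] would be even, as [g] exchanges
    the two vertices of the first level, and then [n / 2] would be a smaller
    period: infinite descent. *)

(** The three commutations are proved together because passing to the section
    at 1 turns each of them into the next one. *)
Lemma bcd_commute w :
  [/\ b_fun (c_fun w) = c_fun (b_fun w), b_fun (d_fun w) = d_fun (b_fun w)
    & c_fun (d_fun w) = d_fun (c_fun w)].
Proof.
elim: w => //= -[] s [IHbc IHbd IHcd] /=; first by rewrite IHbc IHbd IHcd.
by case: s {IHbc IHbd IHcd}.
Qed.

Definition t_tilde : treeAut := b_tilde * c_tilde * d_tilde.

Definition at_tilde : treeAut := a * t_tilde.

Lemma at_tilde_false w : at_tilde (false :: w) = true :: a w.
Proof. by case: w. Qed.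

Lemma at_tilde_true w : at_tilde (true :: w) = false :: t_tilde w.
Proof.
have [eqbc _ _] := bcd_commute (d_fun w).
have [_ eqbd _] := bcd_commute w.
(* The computed section is [c d b]; commuting [b] to the front gives [t]. *)
change (false :: c_fun (d_fun (b_fun w)) = false :: b_fun (c_fun (d_fun w))).
by rewrite eqbc eqbd.
Qed.

(** The self-similarity behind the descent: the section of [(a t)^2] at 1 is
    [a t] itself. *)
Lemma at_tilde_sqr_true w : (at_tilde ^+ 2) (true :: w) = true :: at_tilde w.
Proof.
have -> : (at_tilde ^+ 2) (true :: w) = at_tilde (at_tilde (true :: w)) by [].
by rewrite at_tilde_true at_tilde_false.
Qed.

Lemma treeAut_expSE (g : treeAut) n w : (g ^+ n.+1) w = g ((g ^+ n) w).
Proof. by rewrite expgS. Qed.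

Lemma at_tilde_exp_double_true k w :
  (at_tilde ^+ k.*2) (true :: w) = true :: (at_tilde ^+ k) w.
Proof.
rewrite -mul2n expgnA; elim: k w => [//|k IHk] w.
by rewrite (treeAut_expSE (at_tilde ^+ 2)) IHk at_tilde_sqr_true treeAut_expSE.
Qed.

Lemma at_tilde_infinite_order : has_infinite_order at_tilde.
Proof.
case=> n; elim/ltn_ind: n => n IHn n_gt0 gn1.
have [n_odd|n_even] := boolP (odd n).
  (* An odd power of [a t] moves the vertex 1. *)
  have : (at_tilde ^+ n) [:: true] = [:: true] by rewrite gn1.
  by rewrite -(odd_double_half n) n_odd add1n treeAut_expSE
    at_tilde_exp_double_true at_tilde_true.
have nE : n = n./2.*2 by rewrite -[LHS]odd_double_half (negbTE n_even).
apply: (IHn n./2).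
- by rewrite [ltnRHS]nE -addnn -[ltnLHS]addn0 ltn_add2l -double_gt0 -nE.
- by rewrite -double_gt0 -nE.
apply: treeAutP => w.
have : (at_tilde ^+ n) (true :: w) = true :: w by rewrite gn1.
by rewrite [in LHS]nE at_tilde_exp_double_true => -[].
Qed.

Lemma generated_subgroupM (gT : groupType) (A : set gT) (x y : gT) :
  x \in generated_subgroup A -> y \in generated_subgroup A ->
  x * y \in generated_subgroup A.
Proof.
move=> /set_mem Gx /set_mem Gy; apply/mem_set => H HA; have [Hgrp _] := HA.
have Hx : x \in H by apply/mem_set/(Gx H HA).
have Hy : y \in H by apply/mem_set/(Gy H HA).
have Hxy := group_closedM Hgrp Hx Hy.
exact: set_mem Hxy.
Qed.

Lemma generator_in_G_tilde g :
  [set a; b_tilde; c_tilde; d_tilde]%classic g -> g \in G_tilde.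
Proof. by move=> Ag; apply: mem_set; apply: sub_gen_smallest. Qed.

Theorem proposition5p1 :
  (exists g : treeAut, [/\ g \in G_tilde, g <> 1 & has_finite_order g]) /\
  (exists g : treeAut, g \in G_tilde /\ has_infinite_order g).
Proof.
have aG : a \in G_tilde by apply: generator_in_G_tilde; do 3!left.
have bG : b_tilde \in G_tilde by apply: generator_in_G_tilde; do 2!left; right.
have cG : c_tilde \in G_tilde by apply: generator_in_G_tilde; left; right.
have dG : d_tilde \in G_tilde by apply: generator_in_G_tilde; right.
split; [exists a; split=> // | exists at_tilde; split].
- by move/(congr1 (fun g : treeAut => g [:: true])).
- by exists 2 => //; apply: treeAutP => w; exact: a_funK.
- by do !apply: generated_subgroupM.
- exact: at_tilde_infinite_order.
Qed.
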